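(* Let $G$ be a Lie group, $C:G\to\mathbb R$ a cost function, $F(\cdot,u)$ a vector field on $G$ depending on a parameter $u\in U$, with left-trivialization $f(g,u)=g^{-1}\cdot F(g,u)\in\mathfrak g$, $\tau:\mathfrak g\to G$ a retraction, $N\ge1$, $\Delta t>0$, and $g_0\in G$ independent of $u$. For $u\in U$ let $\{g_k\}_{k=0}^N$ be defined by $\xi_{k+1}=f(g_k,u)$, $g_{k+1}=g_k\,\tau(\Delta t\,\xi_{k+1})$ for $0\le k\le N-1$, and regard $C(g_N)$ as a function of $u$. Then the discrete parameter sensitivity is given by $$\frac{d}{du}C(g_N)=\Delta t\sum_{j=0}^{N-1}\Big\langle m_{j+1},\frac{\partial}{\partial u}f(g_j,u)\Big\rangle,$$ where $m_1,\dots,m_N\in\mathfrak g^*$ are chosen to satisfy the discrete Lie--Poisson adjoint equation $$(d\tau^{-1}_{\Delta t\xi_{k+1}})^*m_{k+1}-\mathrm{Ad}^*_{\tau(\Delta t\xi_k)}(d\tau^{-1}_{\Delta t\xi_k})^*m_k=-\Delta t\,g_k^*\cdot[D_gf(g_k,u)]^*m_{k+1}\qquad(1\le k\le N-1)$$ and the terminal condition $m_N=(d\tau_{-\Delta t\xi_N})^*\,d_LC(g_N)$.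
   Context: $C$ is smooth; $F$ is smooth in $g$ and continuously differentiable with respect to $u$ (jointly $C^1$ in $(g,u)$). The parameter set $U$ is a vector space or a manifold; the identity is one of covectors on $T_uU$ (i.e. it holds when both sides are evaluated on any $\delta u\in T_uU$). $\langle\cdot,\cdot\rangle$ is the duality pairing. With $L_g(x)=gx$: $g^{-1}\cdot v_g:=T_gL_{g^{-1}}(v_g)\in\mathfrak g$ for $v_g\in T_gG$, and $g^*\cdot p_g:=T_e^*L_g(p_g)\in\mathfrak g^*$ (dual of $T_eL_g$) for $p_g\in T_g^*G$. The left-trivialized derivative of $C$ is $d_LC(g):=g^*\cdot dC(g)\in\mathfrak g^*$. $D_gf(g,u):T_gG\to\mathfrak g$ is the derivative of $f$ in $g$ with $u$ fixed, $[D_gf(g,u)]^*:\mathfrak g^*\to T_g^*G$ its dual, and $\frac{\partial}{\partial u}f(g,u)$ the derivative in $u$ with $g$ fixed. A retraction $\tau:\mathfrak g\to G$ is a map that is a $C^2$-diffeomorphism from a neighborhood of $0$ onto a neighborhood of $e$, with $\tau(0)=e$ and $\tau(-\xi)=\tau(\xi)^{-1}$. All elements $\pm\Delta t\,\xi_k$ are assumed to lie in this neighborhood. $d\tau_\xi:\mathfrak g\to\mathfrak g$ is the right-trivialized tangent: $T_\xi\tau(\eta)=T_eR_{\tau(\xi)}(d\tau_\xi\eta)$ with $R_g(x)=xg$. $d\tau_\xi^{-1}$ is its inverse, and $(\cdot)^*$ on these maps denotes the dual map on $\mathfrak g^*$. $\mathrm{Ad}^*_g$ is the dual of $\mathrm{Ad}_g$: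 $\langle\mathrm{Ad}^*_g\mu,\eta\rangle=\langle\mu,\mathrm{Ad}_g\eta\rangle$. With these conventions $\mathrm{Ad}^*_{\tau(\xi)}(d\tau^{-1}_\xi)^*=(d\tau^{-1}_{-\xi})^*$. *)

(* Defs.v *)
From HB Require Import structures.
From mathcomp Require Import all_boot all_order all_algebra.
From mathcomp Require Import all_classical all_reals all_analysis.

Set Implicit Arguments.
Unset Strict Implicit.
Unset Printing Implicit Defensive.

Import Order.TTheory GRing.Theory Num.Theory.
Import numFieldNormedType.Exports.

Local Open Scope classical_set_scope.
Local Open Scope ring_scope.

#[short(type="normedVectType")]
HB.structure Definition NormedVect (R : realType) :=
  {V of NormedModule R V & Vector R V}.

HB.instance Definition _ (R : realType) := NormedModule.on R^o.
HB.instance Definition _ (R : realType) (m n : nat) := NormedModule.on 'M[R]_(m, n).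
HB.instance Definition _ (R : realType) (E F : normedVectType R) :=
  NormedModule.on (E * F)%type.

(* [f] is of class C^k on the set [A], which is open in all uses below.  In
   finite dimension, C^k.+1 means that [f] is differentiable and that each
   directional derivative x |-> 'd f x v is C^k. *)
Fixpoint class_on (R : realType) (E F : normedVectType R) (k : nat)
    (A : set E) (f : E -> F) : Prop :=
  match k with
  | 0 => forall x, A x -> {for x, continuous f}
  | k'.+1 => (forall x, A x -> differentiable f x) /\
             (forall v : E, class_on k' A (fun x => 'd f x v))
  end.

(* A chart is a homeomorphism from the open set [cdom] of [M] onto the open set
   [cimg] of [E]; outside these sets [cmap] and [cinv] are irrelevant. *)
Record chart (R : realType) (E : normedVectType R) (M : topologicalType) :=
  Chart {
    cdom : set M;
    cimg : set E;
    cmap : M -> E;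
    cinv : E -> M;
    cdom_open : open cdom;
    cimg_open : open cimg;
    cmap_img : forall x, cdom x -> cimg (cmap x);
    cinv_dom : forall y, cimg y -> cdom (cinv y);
    cmapK : forall x, cdom x -> cinv (cmap x) = x;
    cinvK : forall y, cimg y -> cmap (cinv y) = y;
    cmap_continuous : forall x, cdom x -> {for x, continuous cmap};
    cinv_continuous : forall y, cimg y -> {for y, continuous cinv}
  }.

(* An atlas, without any compatibility condition, together with a preferred
   chart around each point; the latter gives concrete tangent spaces. *)
Record charted (R : realType) (E : normedVectType R) (M : topologicalType) :=
  Charted {
    atlas : set (chart E M);
    chart_at : M -> chart E M;
    chart_at_atlas : forall x, atlas (chart_at x);
    chart_at_dom : forall x, cdom (chart_at x) x
  }.

Section VectorSpace.
Context (R : realType) (E : normedVectType R).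

Definition id_chart : chart E E :=
  @Chart R E E setT setT idfun idfun openT openT (fun _ _ => I) (fun _ _ => I)
    (fun _ _ => erefl) (fun _ _ => erefl)
    (fun _ _ => cvg_id) (fun _ _ => cvg_id).

Definition vec_charted : charted E E :=
  @Charted R E E [set id_chart] (fun=> id_chart) (fun=> erefl) (fun=> I).

End VectorSpace.

Section Product.
#[local] Obligation Tactic := idtac.
Context (R : realType) (E F : normedVectType R) (M N : topologicalType).

Lemma openX (S T : topologicalType) (A : set S) (B : set T) :
  open A -> open B -> open (A `*` B).
Proof.
rewrite !openE => oA oB [x y] [/= Ax By].
by exists (A, B) => //; split; [exact: oA|exact: oB].
Qed.

Lemma pair_continuous (S T S' T' : topologicalType) (f : S -> S') (g : T -> T')
    (p : S * T) :
  {for p.1, continuous f} -> {for p.2, continuous g} ->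
  {for p, continuous (fun q : S * T => (f q.1, g q.2))}.
Proof.
move=> cf cg; apply: cvg_pair => /=.
- exact: (@continuous_comp _ _ _ fst f p cvg_fst cf).
- exact: (@continuous_comp _ _ _ snd g p cvg_snd cg).
Qed.

Program Definition prod_chart (c : chart E M) (d : chart F N) :
    chart (E * F)%type (M * N)%type :=
  @Chart R (E * F)%type (M * N)%type
    (cdom c `*` cdom d) (cimg c `*` cimg d)
    (fun p => (cmap c p.1, cmap d p.2)) (fun q => (cinv c q.1, cinv d q.2))
    _ _ _ _ _ _ _ _.
Next Obligation. by move=> c d; apply: openX; exact: cdom_open. Qed.
Next Obligation. by move=> c d; apply: openX; exact: cimg_open. Qed.
Next Obligation. by move=> c d [x y] [hx hy]; split; exact: cmap_img. Qed.
Next Obligation. by move=> c d [x y] [hx hy]; split; exact: cinv_dom. Qed.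
Next Obligation. by move=> c d [x y] [hx hy]; rewrite /= !cmapK. Qed.
Next Obligation. by move=> c d [x y] [hx hy]; rewrite /= !cinvK. Qed.
Next Obligation.
by move=> c d [x y] [hx hy]; apply: pair_continuous; exact: cmap_continuous.
Qed.
Next Obligation.
by move=> c d [x y] [hx hy]; apply: pair_continuous; exact: cinv_continuous.
Qed.

Program Definition prod_charted (X : charted E M) (Y : charted F N) :
    charted (E * F)%type (M * N)%type :=
  @Charted R (E * F)%type (M * N)%type
    [set prod_chart c d | c in atlas X & d in atlas Y]
    (fun p => prod_chart (chart_at X p.1) (chart_at Y p.2)) _ _.
Next Obligation.
move=> X Y [x y] /=; exists (chart_at X x); first exact: chart_at_atlas.
by exists (chart_at Y y) => //; exact: chart_at_atlas.
Qed.
Next Obligation. by move=> X Y [x y]; split; exact: chart_at_dom. Qed.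

End Product.

Section Maps.
Context (R : realType) (E F : normedVectType R) (M N : topologicalType).
Context (X : charted E M) (Y : charted F N).

Definition mclass_on (k : nat) (A : set M) (f : M -> N) : Prop :=
  (forall x, A x -> {for x, continuous f}) /\
  forall c d, atlas X c -> atlas Y d ->
    class_on k (cimg c `&` (cinv c @^-1` (A `&` f @^-1` cdom d)))
      (cmap d \o f \o cinv c).

Definition msmooth (f : M -> N) : Prop := forall k, mclass_on k setT f.

End Maps.

(* The tangent space at [x] is the model space: a tangent vector is given by
   its coordinates in the preferred chart at [x]. *)
Definition tangent (R : realType) (E : normedVectType R) (M : topologicalType)
  (X : charted E M) (x : M) : normedVectType R := E.

Section Differential.
Context (R : realType) (E F : normedVectType R) (M N : topologicalType).
Context (X : charted E M) (Y : charted F N).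

Definition local_repr (f : M -> N) (x : M) : E -> F :=
  cmap (chart_at Y (f x)) \o f \o cinv (chart_at X x).

Definition mdifferentiable (f : M -> N) (x : M) : Prop :=
  {for x, continuous f} /\
  differentiable (local_repr f x) (cmap (chart_at X x) x).

(* The tangent map T_x f : T_x M -> T_(f x) N. *)
Definition mdiff (f : M -> N) (x : M) : 'Hom(tangent X x, tangent Y (f x)) :=
  linfun ('d (local_repr f x) (cmap (chart_at X x) x)).

End Differential.

Section VectorFields.
Context (R : realType) (E F : normedVectType R) (M N : topologicalType).
Context (X : charted E M) (Y : charted F N).

(* [mdiff X (vec_charted E) (cmap c) x v] is the coordinate vector of
   [v : T_x M] in the chart [c]. *)
Definition field_repr (c : chart E M) (V : forall x : M, tangent X x) : E -> E :=
  fun y => mdiff X (vec_charted E) (cmap c) (cinv c y) (V (cinv c y)).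

Definition smooth_field (V : forall x : M, tangent X x) : Prop :=
  forall c, atlas X c -> forall k, class_on k (cimg c) (field_repr c V).

(* The vector fields [V ^~ u] on [M] depend on the parameter [u : N] in such a
   way that [V] is C^1 jointly in both arguments. *)
Definition C1_field_family (V : forall x : M, N -> tangent X x) : Prop :=
  forall c d, atlas X c -> atlas Y d ->
    class_on 1 (cimg c `*` cimg d)
      (fun p : E * F => field_repr c (V ^~ (cinv d p.2)) p.1).

End VectorFields.

Definition is_manifold (R : realType) (E : normedVectType R)
    (M : topologicalType) (X : charted E M) : Prop :=
  [/\ hausdorff_space M, @second_countable M &
      forall c d, atlas X c -> atlas X d -> forall k,
        class_on k (cimg c `&` (cinv c @^-1` cdom d)) (cmap d \o cinv c)].

Record manifold (R : realType) (n : nat) := Manifold {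
  man_sort :> topologicalType;
  man_charted :> charted 'rV[R]_n man_sort;
  man_axioms : is_manifold man_charted
}.

#[short(type="topGroupType")]
HB.structure Definition TopGroup := {G of Topological G & Group G}.

Record lieGroup (R : realType) (n : nat) := LieGroup {
  lie_sort :> topGroupType;
  lie_charted :> charted 'rV[R]_n lie_sort;
  lie_axioms : is_manifold lie_charted;
  lie_mul_smooth : msmooth (prod_charted lie_charted lie_charted) lie_charted
    (fun p : lie_sort * lie_sort => (p.1 * p.2)%g);
  lie_inv_smooth : msmooth lie_charted lie_charted
    (fun x : lie_sort => (x^-1)%g)
}.

Definition covector (R : realType) (V : vectType R) := 'Hom(V, R^o).

Definition dual (R : realType) (V W : vectType R) (A : 'Hom(V, W))
  (mu : covector W) : covector V := (mu \o A)%VF.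

Section LieGroup.
Context (R : realType) (n : nat) (G : lieGroup R n).
Implicit Types x g : G.

Definition lie_algebra : normedVectType R := tangent G (1%g : G).

(* The tangent maps below have values in tangent spaces at points such as
   g^-1 * g or g * 1, which are equal to 1 and g. *)

Definition T1L g : 'Hom(lie_algebra, tangent G g) :=
  mdiff G G (fun x => g * x)%g 1%g.

Definition T1R g : 'Hom(lie_algebra, tangent G g) :=
  mdiff G G (fun x => x * g)%g 1%g.

(* v |-> g^-1 . v *)
Definition left_triv g : 'Hom(tangent G g, lie_algebra) :=
  mdiff G G (fun x => g^-1 * x)%g g.

Definition Ad g : 'Hom(lie_algebra, lie_algebra) :=
  mdiff G G (fun x => g * x * g^-1)%g 1%g.

Definition left_deriv (C : G -> R^o) g : covector lie_algebra :=
  dual (T1L g) (mdiff G (vec_charted R^o) C g).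

(* [ret_dom] is the neighbourhood of 0 on which the retraction is a
   C^2-diffeomorphism. *)
Record retraction := Retraction {
  ret_fun :> lie_algebra -> G;
  ret_dom : set lie_algebra;
  ret_dom_open : open ret_dom;
  ret_dom0 : ret_dom 0;
  ret_diffeo : exists (V : set G) (sigma : G -> lie_algebra),
    [/\ open V,
        forall xi, ret_dom xi -> V (ret_fun xi) /\ sigma (ret_fun xi) = xi,
        forall x, V x -> ret_dom (sigma x) /\ ret_fun (sigma x) = x,
        mclass_on (vec_charted lie_algebra) G 2 ret_dom ret_fun &
        mclass_on G (vec_charted lie_algebra) 2 V sigma];
  ret0 : ret_fun 0 = 1%g;
  retN : forall xi, ret_fun (- xi) = (ret_fun xi)^-1%g
}.

(* The right-trivialized tangent: the solution d of
   T_xi tau = T_1 R_(tau xi) \o d. *)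
Definition dret (tau : retraction) (xi : lie_algebra) :
    'Hom(lie_algebra, lie_algebra) :=
  ((T1R (tau xi))^-1 \o mdiff (vec_charted lie_algebra) G tau xi)%VF.

End LieGroup.

(* Main.v *)
Require Import Defs.
From HB Require Import structures.
From mathcomp Require Import all_boot all_order all_algebra.
From mathcomp Require Import all_classical all_reals all_analysis.

Set Implicit Arguments.
Unset Strict Implicit.
Unset Printing Implicit Defensive.

Import Order.TTheory GRing.Theory Num.Theory.
Import numFieldNormedType.Exports.

Local Open Scope classical_set_scope.
Local Open Scope ring_scope.

(** The proof is the discrete form of the adjoint method.  Write the
    derivative of the trajectory in a direction [du] as
    [T_u g_k du = g_k . eta_k] with [eta_k] in the Lie algebra, and put
    [zeta_k = dt xi_k].  Differentiating [g_(k+1) = g_k tau(zeta_(k+1))] gives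

      [eta_(k+1) = Ad_(tau(zeta)^-1) (eta_k + dtau_zeta (dt delta_k))],

    where [zeta = zeta_(k+1)] and [delta_k = D_g f (g_k . eta_k) + d_u f du]
    is the variation of [xi_(k+1)] ([velocity_step]).  Let [q_k] be the image
    of [m_k] under the dual of [dtau^-1_(zeta_k)], and [p_k] that of [q_k]
    under the dual of [Ad_(tau(zeta_k))].  The recursion for [eta] becomes
    [<p_(k+1), eta_(k+1)> = <q_(k+1), eta_k> + dt <m_(k+1), delta_k>]
    ([costate_step]).  The adjoint equation says exactly that the terms in
    [eta_k] on the right add up to [<p_k, eta_k>], so that

      [<p_(k+1), eta_(k+1)> = <p_k, eta_k> + dt <m_(k+1), d_u f(g_k, u) du>].

    This telescopes from [eta_0 = 0], and the terminal condition means that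
    [p_N] is [d_L C(g_N)] ([costate_terminal]), whose value at [eta_N] is
    the derivative of [C(g_N)].

    Two points need work beyond this computation.  The tangent space at a
    point is the model space, read in a preferred chart that varies with the
    point in an arbitrary way, so the chain rule [mdiff_comp] has to be proved
    through local representatives.  And the left trivialization
    [f (g, u) = g^-1 . F (g, u)] must be shown to be jointly differentiable
    ([mdifferentiable_left_triv]): in fixed charts it is the partial
    derivative of the multiplication at [(g^-1, g)], applied to the coordinates
    of [F], hence a sum of products of differentiable functions.  *)

(** * Differentials in normed spaces *)

Section Differentials.
Context {R : realType} {V W : normedModType R}.

(** [g - f] vanishes near [x], so it is differentiable with zero differential,
    and [g = f + (g - f)]. *)
Lemma near_eq_diff (f g : V -> W) (x : V) :
  (\forall y \near x, f y = g y) -> differentiable f x ->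
  differentiable g x /\ 'd g x = 'd f x :> (V -> W).
Proof.
move=> fg df.
have ox : (g - f) \o shift x = cst ((g - f) x) + (\0 : {linear V -> W}) +o_ 0 id.
  apply/eqaddoP => _/posnumP[e]; near=> h.
  have gfE y : f y = g y -> (g - f) y = 0.
    by move=> fgy; rewrite -[LHS]/(g y - f y) fgy subrr.
  rewrite -[X in `|X|]/((g - f) (h + x) - ((g - f) x + 0)).
  rewrite !gfE ?addr0 ?subrr ?normr0 ?mulr_ge0//.
    exact: (nbhs_singleton fg).
  near: h; rewrite -[X in \forall h \near X, _]/(nbhs (0 : V)).
  by have := fg; rewrite (near_shift 0) subr0.
have c0 : continuous (\0 : {linear V -> W}).
  by move=> ?; exact: cst_continuous.
have d0 := diff_unique c0 ox.
have dgf : differentiable (g - f) x.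
  by apply/diff_locallyP; rewrite d0; split.
have -> : g = f + (g - f) by rewrite addrC subrK.
split; first exact: differentiableD.
rewrite (diffD df dgf) d0; apply/funext => v; exact: addr0.
Unshelve. all: by end_near. Qed.

(** Scaling is a continuous bilinear map. *)
Lemma differentiable_scale (U : normedModType R) (k : U -> R) (w : U -> W)
    (x : U) : differentiable k x -> differentiable w x ->
  differentiable (fun y => k y *: w y) x.
Proof.
move=> dk dw.
have bil : bilinear_for
    (GRing.Scale.Law.clone _ _ *:%R _) (GRing.Scale.Law.clone _ _ *:%R _)
    ( *:%R : R -> W -> W).
  split=> [u'|u] a y z /=; first by rewrite scalerDl scalerA.
  by rewrite scalerDr !scalerA mulrC.
pose sM := bilinear_isBilinear.Build _ _ _ _ _ _ ( *:%R : R -> W -> W) bil.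
pose s : {bilinear R -> W -> W} := HB.pack ( *:%R : R -> W -> W) sM.
apply: (differentiable_comp (f := fun y => (k y, w y))
          (g := fun p : R * W => s p.1 p.2)).
  exact: differentiable_pair.
by apply: differentiable_bilin => p; exact: scale_continuous.
Qed.

End Differentials.

Lemma diff_pairr {R : realType} {V W : normedModType R} (a : V) (y : W) :
  differentiable (fun t : W => (a, t)) y /\
  'd (fun t : W => (a, t)) y = (fun s => (0, s)) :> (W -> V * W).
Proof.
have dc := differentiable_cst a y.
have di : differentiable (@id W) y by exact: ex_diff.
split; first exact: differentiable_pair.
by rewrite (diff_pair dc di) diff_cst diff_val.
Qed.

(** * Tangent maps between charted spaces *)

Lemma mdiffE {R : realType} {E F : normedVectType R} {M N : topologicalType}
    (X : charted E M) (Y : charted F N) (f : M -> N) (x : M) :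
  mdiff X Y f x = 'd (local_repr X Y f x) (cmap (chart_at X x) x) :> (E -> F).
Proof. by apply/funext => v; rewrite /mdiff lfunE. Qed.

Section ManifoldCalculus.
Context {R : realType} {E F K : normedVectType R} {M N P : topologicalType}.
Context (X : charted E M) (Y : charted F N) (Z : charted K P).

(** Only near the base point does [f] stay in the domain of the chart at
    [f x] that is used in the middle. *)
Lemma local_repr_comp (f : M -> N) (h : N -> P) (x : M) :
  {for x, continuous f} ->
  \forall y \near cmap (chart_at X x) x,
  (local_repr Y Z h (f x) \o local_repr X Y f x) y = local_repr X Z (h \o f) x y.
Proof.
move=> cf; set a := cmap _ _.
have xdom := chart_at_dom X x.
have ca : cinv (chart_at X x) a = x by rewrite cmapK.
have dn : nbhs x (f @^-1` cdom (chart_at Y (f x))).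
  apply: cf; apply: open_nbhs_nbhs; split; [exact: cdom_open | exact: chart_at_dom].
have ci := cinv_continuous (cmap_img xdom).
have : nbhs a (cinv (chart_at X x) @^-1` (f @^-1` cdom (chart_at Y (f x)))).
  by apply: ci; rewrite ca.
apply: filterS => y /= fy.
by rewrite /local_repr /= cmapK.
Qed.

(** The intermediate point is a variable [y] with an equation [f x = y]: the
    types of tangent vectors at two equal points, such as [a * 1] and [a],
    mention different terms. *)
Lemma mdifferentiable_comp (f : M -> N) (h : N -> P) (x : M) (y : N) :
  f x = y -> mdifferentiable X Y f x -> mdifferentiable Y Z h y ->
  mdifferentiable X Z (h \o f) x.
Proof.
move=> <- [cf df] [ch dh]; split; first exact: continuous_comp.
have fE : local_repr X Y f x (cmap (chart_at X x) x) = cmap (chart_at Y (f x)) (f x).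
  by rewrite /local_repr /= cmapK//; exact: chart_at_dom.
apply: (near_eq_diff (local_repr_comp h cf) _).1.
by apply: differentiable_comp => //; rewrite fE.
Qed.

Lemma mdiff_comp (f : M -> N) (h : N -> P) (x : M) (y : N) (v : E) :
  f x = y -> mdifferentiable X Y f x -> mdifferentiable Y Z h y ->
  mdiff X Z (h \o f) x v = mdiff Y Z h y (mdiff X Y f x v).
Proof.
move=> <- [cf df] [ch dh].
have fE : local_repr X Y f x (cmap (chart_at X x) x) = cmap (chart_at Y (f x)) (f x).
  by rewrite /local_repr /= cmapK//; exact: chart_at_dom.
rewrite !mdiffE; have [|_ ->] := near_eq_diff (local_repr_comp h cf) _.
  by apply: differentiable_comp => //; rewrite fE.
by rewrite diff_comp//= fE.
Qed.

End ManifoldCalculus.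

Section NearEq.
Context {R : realType} {E F : normedVectType R} {M N : topologicalType}.
Context (X : charted E M) (Y : charted F N).

Lemma chart_at_cmapK (x : M) : cinv (chart_at X x) (cmap (chart_at X x) x) = x.
Proof. by rewrite cmapK//; exact: chart_at_dom. Qed.

Lemma near_cinv (x : M) (P : set M) : nbhs x P ->
  \forall y \near cmap (chart_at X x) x, P (cinv (chart_at X x) y).
Proof.
have := cinv_continuous (cmap_img (chart_at_dom X x)).
by move=> ci Px; apply: ci; rewrite chart_at_cmapK.
Qed.

Lemma near_cdom (c : chart E M) (x : M) : cdom c x -> nbhs x (cdom c).
Proof. by move=> cx; apply: open_nbhs_nbhs; split => //; exact: cdom_open. Qed.

Lemma near_cimg (c : chart E M) (y : E) : cimg c y -> nbhs y (cimg c).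
Proof. by move=> cy; apply: open_nbhs_nbhs; split => //; exact: cimg_open. Qed.

Lemma near_eq_mdiff (f g : M -> N) (x : M) :
  (\forall y \near x, f y = g y) -> mdifferentiable X Y f x ->
  mdifferentiable X Y g x /\ forall v : E, mdiff X Y g x v = mdiff X Y f x v :> F.
Proof.
move=> fg [cf df].
have fgx : f x = g x := nbhs_singleton fg.
have fgl : \forall y \near cmap (chart_at X x) x,
    local_repr X Y f x y = local_repr X Y g x y.
  apply: filterS (near_cinv fg) => y /= e.
  by rewrite /local_repr /= e fgx.
have [dg e] := near_eq_diff fgl df.
split; last by move=> v; rewrite !mdiffE; exact: (congr1 (@^~ v) e).
split => //; rewrite /prop_for /continuous_at -fgx.
by apply: cvg_trans cf; apply: near_eq_cvg.
Qed.

Lemma mclass_on_mdifferentiable (k : nat) (A : set M) (f : M -> N) (x : M) :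
  mclass_on X Y k.+1 A f -> A x -> mdifferentiable X Y f x.
Proof.
move=> [cf df] Ax; split; first exact: cf.
have [+ _] := df _ _ (chart_at_atlas X x) (chart_at_atlas Y (f x)).
apply; split; first exact/cmap_img/chart_at_dom.
by rewrite /preimage /= chart_at_cmapK; split => //; exact: chart_at_dom.
Qed.

Lemma mdifferentiable_cst (y : N) (x : M) : mdifferentiable X Y (cst y) x.
Proof.
split; first exact: cst_continuous.
exact: (@differentiable_cst _ _ _ (cmap (chart_at Y y) y)).
Qed.

Lemma mdiff_cst (y : N) (x : M) (v : E) : mdiff X Y (cst y) x v = 0.
Proof.
rewrite mdiffE.
rewrite -[local_repr _ _ _ _]/(cst (cmap (chart_at Y y) y)).
by rewrite diff_cst.
Qed.

Lemma local_repr_id (x : M) :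
  \forall y \near cmap (chart_at X x) x, y = local_repr X X id x y.
Proof.
apply: filterS (near_cimg (cmap_img (chart_at_dom X x))) => y cy.
by rewrite /local_repr /= cinvK.
Qed.

Lemma mdifferentiable_id (x : M) : mdifferentiable X X id x.
Proof.
split; first by move=> ?.
exact: (near_eq_diff (local_repr_id x) _).1.
Qed.

Lemma mdiff_id (x : M) (v : E) : mdiff X X id x v = v.
Proof.
by rewrite mdiffE (near_eq_diff (local_repr_id x) _).2// diff_val.
Qed.

(** Charts and inverse charts are differentiable because the charts of the
    atlas are compatible with the preferred ones. *)
Lemma mdifferentiable_cmap (c : chart E M) (x : M) :
  is_manifold X -> atlas X c -> cdom c x ->
  mdifferentiable X (vec_charted E) (cmap c) x.
Proof.
move=> [_ _ XX] ac cx; split; first exact: cmap_continuous.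
have [+ _] := XX _ _ (chart_at_atlas X x) ac 1%N; apply; split.
  exact/cmap_img/chart_at_dom.
by rewrite /preimage /= chart_at_cmapK.
Qed.

Lemma mdifferentiable_cinv (c : chart E M) (y : E) :
  is_manifold X -> atlas X c -> cimg c y ->
  mdifferentiable (vec_charted E) X (cinv c) y.
Proof.
move=> [_ _ XX] ac cy; split; first exact: cinv_continuous.
have [+ _] := XX _ _ ac (chart_at_atlas X (cinv c y)) 1%N; apply; split => //.
exact: chart_at_dom.
Qed.

End NearEq.

Section VectorSpaces.
Context {R : realType} {E F : normedVectType R}.

Lemma mdifferentiable_vec (f : E -> F) (x : E) :
  differentiable f x -> mdifferentiable (vec_charted E) (vec_charted F) f x.
Proof. by move=> df; split => //; exact: differentiable_continuous. Qed.

Lemma mdiff_vec (f : E -> F) (x : E) :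
  mdiff (vec_charted E) (vec_charted F) f x = 'd f x :> (E -> F).
Proof. by rewrite mdiffE. Qed.

End VectorSpaces.

Section Products.
Context {R : realType} {E F K : normedVectType R} {M N P : topologicalType}.
Context (X : charted E M) (Y : charted F N) (Z : charted K P).

Lemma mdifferentiable_pair (f : M -> N) (h : M -> P) (x : M) :
  mdifferentiable X Y f x -> mdifferentiable X Z h x ->
  mdifferentiable X (prod_charted Y Z) (fun y => (f y, h y)) x.
Proof.
move=> [cf df] [ch dh]; split; first exact: cvg_pair.
exact: differentiable_pair.
Qed.

Lemma mdiff_pair (f : M -> N) (h : M -> P) (x : M) (v : E) :
  mdifferentiable X Y f x -> mdifferentiable X Z h x ->
  mdiff X (prod_charted Y Z) (fun y => (f y, h y)) x v
  = (mdiff X Y f x v, mdiff X Z h x v).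
Proof.
move=> [cf df] [ch dh]; rewrite !mdiffE.
exact: (congr1 (@^~ v) (diff_pair df dh)).
Qed.
End Products.

Section Partial.
Context {R : realType} {E F K : normedVectType R} {M N P : topologicalType}.
Context (X : charted E M) (Y : charted F N) (Z : charted K P).
Variables (h : M * N -> P) (a : M) (b : N).
Hypothesis dh : mdifferentiable (prod_charted X Y) Z h (a, b).

Lemma mdifferentiable_partial1 : mdifferentiable X Z (fun x => h (x, b)) a.
Proof.
apply: (mdifferentiable_comp (Y := prod_charted X Y) _ _ dh) => //.
by apply: mdifferentiable_pair; [exact: mdifferentiable_id|exact: mdifferentiable_cst].
Qed.

Lemma mdifferentiable_partial2 : mdifferentiable Y Z (fun y => h (a, y)) b.
Proof.
apply: (mdifferentiable_comp (Y := prod_charted X Y) _ _ dh) => //.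
by apply: mdifferentiable_pair; [exact: mdifferentiable_cst|exact: mdifferentiable_id].
Qed.

Lemma mdiff_partial (v : E) (w : F) :
  mdiff (prod_charted X Y) Z h (a, b) (v, w) =
  (mdiff X Z (fun x => h (x, b)) a v : K) + mdiff Y Z (fun y => h (a, y)) b w.
Proof.
have id1 := mdifferentiable_id X a; have id2 := mdifferentiable_id Y b.
have c1 := mdifferentiable_cst X Y b a; have c2 := mdifferentiable_cst Y X a b.
have -> : (v, w) = ((v, 0) + (0, w)) :> E * F.
  by congr (_, _); rewrite ?addr0 ?add0r.
rewrite linearD; congr (_ + _).
- rewrite (mdiff_comp (f := fun x => (x, b)) v erefl (mdifferentiable_pair id1 c1) dh).
  by rewrite (mdiff_pair v id1 c1) mdiff_id mdiff_cst.
- rewrite (mdiff_comp (f := fun y => (a, y)) w erefl (mdifferentiable_pair c2 id2) dh).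
  by rewrite (mdiff_pair w c2 id2) mdiff_id mdiff_cst.
Qed.

End Partial.

Section TotalDerivative.
Context {R : realType} {E F K : normedVectType R} {M N : topologicalType}.
Context (X : charted E M) (Y : charted F N).
Variables (h : M -> N -> K) (a : N -> M) (u : N).
Hypothesis dh : mdifferentiable (prod_charted X Y) (vec_charted K)
  (fun q : M * N => h q.1 q.2) (a u, u).
Hypothesis da : mdifferentiable Y X a u.

Lemma mdifferentiable_total :
  mdifferentiable Y (vec_charted K) (fun v => h (a v) v) u.
Proof.
exact: (mdifferentiable_comp erefl
  (mdifferentiable_pair da (mdifferentiable_id Y u)) dh).
Qed.

Lemma mdiff_total (w : F) :
  mdiff Y (vec_charted K) (fun v => h (a v) v) u w
  = (mdiff X (vec_charted K) (h ^~ u) (a u) (mdiff Y X a u w) : K)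
    + mdiff Y (vec_charted K) (h (a u)) u w.
Proof.
have did := mdifferentiable_id Y u.
have := mdiff_comp w erefl (mdifferentiable_pair da did) dh.
rewrite mdiff_pair// => e; apply: etrans e _.
apply: etrans (mdiff_partial dh _ _) _.
by rewrite mdiff_id.
Qed.
End TotalDerivative.

Section Scaling.
Context {R : realType} {E K : normedVectType R} {M : topologicalType}.
Context (X : charted E M) (a : R) (h : M -> K) (x : M).
Hypothesis dh : mdifferentiable X (vec_charted K) h x.

Let da : mdifferentiable (vec_charted K) (vec_charted K) ( *:%R a) (h x).
Proof. apply: mdifferentiable_vec; exact: ex_diff. Qed.

Lemma mdifferentiable_scaler :
  mdifferentiable X (vec_charted K) (fun y => a *: h y) x.
Proof. exact: mdifferentiable_comp erefl dh da. Qed.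

Lemma mdiff_scaler (v : E) :
  mdiff X (vec_charted K) (fun y => a *: h y) x v
  = a *: (mdiff X (vec_charted K) h x v : K).
Proof.
have := mdiff_comp v erefl dh da => e; apply: etrans e _.
by apply: etrans (congr1 (@^~ _) (mdiff_vec _ _)) _; rewrite diff_val.
Qed.
End Scaling.

(** * Translations of a Lie group and the adjoint action *)

Section LieGroups.
Context {R : realType} {n : nat} (G : lieGroup R n).
Implicit Types a b c x : G.

(** The tangent maps of the translations, with values in the model space:
    the group laws then rewrite base points without changing any type. *)
Definition dL a b : 'rV[R]_n -> 'rV[R]_n := mdiff G G (fun x => a * x)%g b.
Definition dR a b : 'rV[R]_n -> 'rV[R]_n := mdiff G G (fun x => x * a)%g b.

Lemma mdifferentiable_mul a b :
  mdifferentiable (prod_charted G G) G (fun p : G * G => p.1 * p.2)%g (a, b).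
Proof. by apply: (mclass_on_mdifferentiable (lie_mul_smooth G 1)). Qed.

Lemma mdifferentiable_inv a : mdifferentiable G G (fun x : G => x^-1)%g a.
Proof. by apply: (mclass_on_mdifferentiable (lie_inv_smooth G 1)). Qed.

Lemma mdifferentiable_mull a b : mdifferentiable G G (fun x => a * x)%g b.
Proof. exact: mdifferentiable_partial2 (mdifferentiable_mul a b). Qed.

Lemma mdifferentiable_mulr a b : mdifferentiable G G (fun x => x * a)%g b.
Proof. exact: mdifferentiable_partial1 (mdifferentiable_mul b a). Qed.

Lemma dL_is_linear a b : linear (dL a b). Proof. exact: linearP. Qed.
HB.instance Definition _ a b :=
  GRing.isLinear.Build R 'rV[R]_n 'rV[R]_n _ (dL a b) (dL_is_linear a b).
Lemma dR_is_linear a b : linear (dR a b). Proof. exact: linearP. Qed.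
HB.instance Definition _ a b :=
  GRing.isLinear.Build R 'rV[R]_n 'rV[R]_n _ (dR a b) (dR_is_linear a b).

Lemma dLM a b c v : dL a (b * c)%g (dL b c v) = dL (a * b)%g c v.
Proof.
have e : (fun x => a * x)%g \o (fun x => b * x)%g = (fun x => a * b * x)%g.
  by apply/funext => x /=; rewrite mulgA.
have := mdiff_comp v erefl (mdifferentiable_mull b c) (mdifferentiable_mull a (b * c)%g).
by rewrite e => /esym.
Qed.

Lemma dRM a b c v : dR b (c * a)%g (dR a c v) = dR (a * b)%g c v.
Proof.
have e : (fun x => x * b)%g \o (fun x => x * a)%g = (fun x => x * (a * b))%g.
  by apply/funext => x /=; rewrite mulgA.
have := mdiff_comp v erefl (mdifferentiable_mulr a c) (mdifferentiable_mulr b (c * a)%g).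
by rewrite e => /esym.
Qed.

Lemma dLR a b c v : dL a (c * b)%g (dR b c v) = dR b (a * c)%g (dL a c v).
Proof.
have e : (fun x => a * x)%g \o (fun x => x * b)%g =
         (fun x => x * b)%g \o (fun x => a * x)%g.
  by apply/funext => x /=; rewrite mulgA.
have := mdiff_comp v erefl (mdifferentiable_mulr b c) (mdifferentiable_mull a (c * b)%g).
have := mdiff_comp v erefl (mdifferentiable_mull a c) (mdifferentiable_mulr b (a * c)%g).
by rewrite e => e1 e2; exact: etrans (esym e2) e1.
Qed.

Lemma dL1 b v : dL 1%g b v = v.
Proof.
rewrite /dL (_ : (fun x => 1 * x)%g = id) ?mdiff_id//.
by apply/funext => x; rewrite mul1g.
Qed.

Lemma dR1 b v : dR 1%g b v = v.
Proof.
rewrite /dR (_ : (fun x => x * 1)%g = id) ?mdiff_id//.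
by apply/funext => x; rewrite mulg1.
Qed.

Lemma dRK a v : dR a^-1%g a (dR a 1%g v) = v.
Proof. by rewrite -[X in dR _ X]mul1g dRM mulgV dR1. Qed.

Lemma dRVK a v : dR a 1%g (dR a^-1%g a v) = v.
Proof. by rewrite -[X in dR _ X](mulgV a) dRM mulVg dR1. Qed.

Lemma AdE a (v : 'rV[R]_n) : Ad a v = dR a^-1%g a (dL a 1%g v).
Proof.
exact: (mdiff_comp v (mulg1 a) (mdifferentiable_mull a 1%g)
          (mdifferentiable_mulr a^-1%g a)).
Qed.

(** Both sides are the derivative at [1] of [x |-> a * x * b], since
    [a * x * b = (a * b) * (b^-1 * x * b)]. *)
Lemma dL_AdV a b v : dL (a * b)%g 1%g (Ad b^-1%g v) = dR b a (dL a 1%g v).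
Proof.
have := dLR (a * b)%g b b^-1%g (dL b^-1%g 1%g v).
have := dLM (a * b)%g b^-1%g 1%g v.
by rewrite mulVg mulg1 mulgK AdE invgK => -> ->.
Qed.

Lemma AdK b (v : lie_algebra G) : Ad b (Ad b^-1%g v) = v.
Proof.
apply: etrans (AdE _ _) _; have := dL_AdV 1%g b v.
by rewrite mul1g dL1 => ->; rewrite dRK.
Qed.

(** The velocity of a product [a * b] when those of [a] and [b] are
    [a . v] and [w . b]: the right-trivialized [w] and the left-trivialized [v]
    meet between the two factors, and [Ad b^-1] carries their sum to the right. *)
Lemma dL_step a b (v w : lie_algebra G) :
  dR b a (dL a 1%g v) + dL a b (dR b 1%g w)
  = dL (a * b)%g 1%g (Ad b^-1%g (v + w)).
Proof.
have e := dLR a b 1%g w; rewrite mul1g mulg1 in e.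
rewrite e dL_AdV.
apply: etrans (esym (linearD (dR b a) _ _)) _.
congr (dR b a _).
exact: (esym (linearD (dL a 1%g) v w)).
Qed.

End LieGroups.

Section ProductRule.
Context {R : realType} {n : nat} (G : lieGroup R n).
Context {E : normedVectType R} {M : topologicalType} (X : charted E M).
Variables (a b : M -> G) (x : M).
Hypotheses (da : mdifferentiable X G a x) (db : mdifferentiable X G b x).

Lemma mdifferentiable_mulg : mdifferentiable X G (fun y => a y * b y)%g x.
Proof.
exact: (mdifferentiable_comp erefl (mdifferentiable_pair da db)
          (mdifferentiable_mul (a x) (b x))).
Qed.

Lemma mdiff_mulg (v : E) :
  mdiff X G (fun y => a y * b y)%g x v
  = dR (b x) (a x) (mdiff X G a x v) + dL (a x) (b x) (mdiff X G b x v).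
Proof.
have := mdiff_comp v erefl (mdifferentiable_pair da db)
          (mdifferentiable_mul (a x) (b x)).
rewrite mdiff_pair// => e; apply: etrans e _.
exact: (mdiff_partial (mdifferentiable_mul (a x) (b x))).
Qed.

End ProductRule.

(** * The right-trivialized tangent of a retraction *)

Section Retraction.
Context {R : realType} {n : nat} {G : lieGroup R n} (tau : retraction G).
Implicit Types z : lie_algebra G.

Definition dtau z : 'rV[R]_n -> 'rV[R]_n := mdiff (vec_charted (lie_algebra G)) G tau z.

Lemma dtau_is_linear z : linear (dtau z). Proof. exact: linearP. Qed.
HB.instance Definition _ z :=
  GRing.isLinear.Build R 'rV[R]_n 'rV[R]_n _ (dtau z) (dtau_is_linear z).

Lemma mdifferentiable_ret z : ret_dom tau z ->
  mdifferentiable (vec_charted (lie_algebra G)) G tau z.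
Proof.
case: (ret_diffeo tau) => V [sigma [_ _ _ ct _]] dz.
exact: mclass_on_mdifferentiable ct dz.
Qed.

(** The local inverse of [tau] gives a left inverse of the tangent map. *)
Lemma dtau_inj z : ret_dom tau z -> injective (dtau z).
Proof.
move=> dz; have dt := mdifferentiable_ret dz.
case: (ret_diffeo tau) => V [sigma [_ tV _ _ cs]].
have ds := mclass_on_mdifferentiable cs (tV _ dz).1.
have near_id : \forall y \near z, y = (sigma \o tau) y.
  have : nbhs z (ret_dom tau).
    by apply: open_nbhs_nbhs; split => //; exact: ret_dom_open.
  by apply: filterS => y /tV[].
have [_ e] := near_eq_mdiff near_id (mdifferentiable_id (vec_charted (lie_algebra G)) z).
apply: (can_inj (g := mdiff G (vec_charted (lie_algebra G)) sigma (tau z))) => v.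
have e1 := mdiff_comp v erefl dt ds.
have e2 := mdiff_id (vec_charted (lie_algebra G)) z v.
have e3 := e v.
apply: etrans (esym e1) _.
apply: etrans e3 _.
exact: e2.
Qed.

(** The inverse in the definition of [dret] is only a right inverse on the
    image of [T1R], which is everything because right translations are
    invertible. *)
Lemma dR_dret z (v : 'rV[R]_n) : dR (tau z) 1%g (dret tau z v) = dtau z v.
Proof.
rewrite /dret comp_lfunE.
have sur (w : 'rV[R]_n) : w \in limg (T1R (tau z)).
  pose w' : lie_algebra G := dR (tau z)^-1%g (tau z) w.
  rewrite -(dRVK (tau z) w); exact: (memv_img (T1R (tau z)) (memvf w')).
exact: limg_lfunVK (sur _).
Qed.

Lemma lker_dret z : ret_dom tau z -> lker (dret tau z) == 0%VS.
Proof.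
move=> dz; apply/lker0P => v w e; apply: (dtau_inj dz).
by rewrite -!dR_dret e.
Qed.

(** Differentiating [tau y * tau (- y) = 1] at [z] in the direction [v]. *)
Lemma dretN z (v : 'rV[R]_n) : ret_dom tau z -> ret_dom tau (- z) ->
  dret tau (- z) v = Ad (tau z)^-1%g (dret tau z v).
Proof.
move=> dz dNz; set L := lie_algebra G.
have ddN : differentiable (-%R : L -> L) z by exact: linear_differentiable opp_continuous.
have dmN := mdifferentiable_vec ddN.
have dt := mdifferentiable_ret dz; have dtN := mdifferentiable_ret dNz.
have dtN' := mdifferentiable_comp erefl dmN dtN.
have e := mdiff_mulg dt dtN' v.
have tau1 : (fun y => tau y * (tau \o -%R) y)%g = cst 1%g.
  by apply/funext => y /=; rewrite retN mulgV.
rewrite tau1 in e.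
have e0 := etrans (esym (mdiff_cst (vec_charted L) G 1%g z v)) e.
have eN := mdiff_comp v erefl dmN dtN.
have eNv : mdiff (vec_charted L) (vec_charted L) -%R z v = - v :> 'rV[R]_n.
  apply: etrans (congr1 (@^~ v) (mdiff_vec _ _)) _.
  by rewrite (diff_lin _ opp_continuous).
have eN' : (mdiff (vec_charted L) G (tau \o -%R) z v : 'rV[R]_n) = - dtau (- z) v.
  apply: etrans eN _.
  rewrite -[LHS]/(dtau (- z) (mdiff (vec_charted L) (vec_charted L) -%R z v)).
  by rewrite eNv linearN.
move: e0; rewrite [X in dL _ _ X]eN' -[X in dR _ _ X]/(dtau z v) /= retN.
rewrite -dR_dret dRK linearN => /esym/subr0_eq e0.
apply: (can_inj (dRK (tau (- z)))); rewrite dR_dret retN.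
rewrite AdE [in RHS]dRVK e0.
by have := dLM (tau z)^-1%g (tau z) (tau z)^-1%g (dtau (- z) v); rewrite mulgV mulVg dL1.
Qed.

End Retraction.

(** * Joint differentiability of the left trivialization *)

Section LeftTrivialization.
Context {R : realType} {n : nat} (G : lieGroup R n).
Context {E : normedVectType R} {U : topologicalType} (Y : charted E U).
Local Notation rV := 'rV[R]_n.

(** The multiplication in coordinates around [(x^-1, x)].  Reading the left
    factor in a chart at [x^-1] keeps [g^-1 * z] a composite of two known
    smooth maps, so that second-order regularity is needed for the
    multiplication alone and never for a composite. *)
Definition mul_repr (x : G) : rV * rV -> rV :=
  cmap (chart_at G 1%g) \o (fun p : G * G => p.1 * p.2)%g
  \o cinv (prod_chart (chart_at G x^-1%g) (chart_at G x)).

Definition inv_graph (x : G) (y : rV) : rV * rV :=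
  (local_repr G G (fun z : G => z^-1)%g x y, y).

Definition mul_repr_dom (x : G) : set (rV * rV) :=
  cimg (prod_chart (chart_at G x^-1%g) (chart_at G x)) `&`
  (cinv (prod_chart (chart_at G x^-1%g) (chart_at G x)) @^-1`
   (setT `&` (fun p : G * G => p.1 * p.2)%g @^-1` cdom (chart_at G 1%g))).

Lemma mul_repr_class (x : G) : class_on 2 (mul_repr_dom x) (mul_repr x).
Proof.
have [_ +] := lie_mul_smooth G 2; apply; last exact: chart_at_atlas.
exists (chart_at G x^-1%g); first exact: chart_at_atlas.
by exists (chart_at G x) => //; exact: chart_at_atlas.
Qed.

Lemma inv_graph_dom (x : G) (y : rV) :
  cimg (chart_at G x) y -> cdom (chart_at G x^-1%g) (cinv (chart_at G x) y)^-1%g ->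
  mul_repr_dom x (inv_graph x y).
Proof.
move=> cy dy; rewrite /mul_repr_dom /inv_graph /local_repr /preimage /=; split => /=.
  by split => //=; exact: cmap_img.
by split => //; rewrite cmapK// mulVg; exact: chart_at_dom.
Qed.

(** [left_triv] is defined through the preferred chart at the moving point;
    the chain rule through the fixed chart at [x] replaces it by a partial
    derivative of [mul_repr], and the change of chart is absorbed in the
    coordinates of [v]. *)
Lemma left_triv_repr (x : G) (y : rV) (v : tangent G (cinv (chart_at G x) y)) :
  cimg (chart_at G x) y -> cdom (chart_at G x^-1%g) (cinv (chart_at G x) y)^-1%g ->
  left_triv (cinv (chart_at G x) y) v
  = 'd (mul_repr x) (inv_graph x y)
      (0, mdiff G (vec_charted rV) (cmap (chart_at G x)) (cinv (chart_at G x) y) v).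
Proof.
move=> cy dy; set c := chart_at G x; set z := cinv c y.
have cz : cdom c z by exact: cinv_dom.
have dcm := mdifferentiable_cmap (lie_axioms G) (chart_at_atlas G x) cz.
have dci := mdifferentiable_cinv (lie_axioms G) (chart_at_atlas G x) cy.
have dh := mdifferentiable_comp erefl dci (mdifferentiable_mull z^-1%g z).
set h := (_ \o _) in dh.
have near_h : \forall t \near z, (h \o cmap c) t = (z^-1 * t)%g.
  by apply: filterS (near_cdom cz) => t ct; rewrite /h /= cmapK.
have dhc := mdifferentiable_comp (cinvK cy) dcm dh.
have [_ e1] := near_eq_mdiff near_h dhc.
have e2 := mdiff_comp v (cinvK cy) dcm dh.
suff dhE (s : rV) : mdiff (vec_charted rV) G h y s
    = 'd (mul_repr x) (inv_graph x y) (0, s) :> rV.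
  by apply: etrans (e1 v) _; apply: etrans e2 _; exact: dhE.
rewrite mdiffE.
have -> : local_repr (vec_charted rV) G h y
    = mul_repr x \o (fun t => ((inv_graph x y).1, t)).
  have hy : h y = 1%g by rewrite /h /= mulVg.
  rewrite /local_repr hy; apply/funext => t /=.
  by rewrite /mul_repr /inv_graph /local_repr /= cmapK.
have [dm _] := mul_repr_class x.
have dmy : differentiable (mul_repr x) (inv_graph x y) by apply: dm; exact: inv_graph_dom.
have [di dE] := diff_pairr (inv_graph x y).1 y.
apply: etrans (congr1 (@^~ s) (diff_comp di dmy)) _.
exact: congr1 (congr1 (@^~ s) dE).
Qed.

Lemma inv_graph_diff (x : G) :
  differentiable (inv_graph x) (cmap (chart_at G x) x).
Proof.
have [_ di] := mdifferentiable_inv x.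
by apply: differentiable_pair => //; exact: ex_diff.
Qed.

Lemma near_inv_graph_dom (x : G) : \forall y \near cmap (chart_at G x) x,
  cimg (chart_at G x) y /\ cdom (chart_at G x^-1%g) (cinv (chart_at G x) y)^-1%g.
Proof.
have [ci _] := mdifferentiable_inv x.
have := near_cimg (cmap_img (chart_at_dom G x)).
have := near_cinv G (ci _ (near_cdom (chart_at_dom G x^-1%g))).
by apply: filterS2 => y.
Qed.

Lemma diff_mul_repr_sum (x : G) (q : rV * rV) (s : rV) :
  'd (mul_repr x) q (0, s)
  = \sum_(i < n) s 0 i *: ('d (mul_repr x) q (0, delta_mx 0 i) : rV).
Proof.
have -> : (0, s) = \sum_(i < n) s 0 i *: ((0, delta_mx 0 i) : rV * rV).
  rewrite [in LHS](row_sum_delta s).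
  rewrite (big_morph (fun t : rV => (0, t) : rV * rV) (id1 := 0) (op1 := +%R))//.
    by apply: eq_bigr => i _; congr (_, _); rewrite scaler0.
  by move=> a b; congr (_, _); rewrite addr0.
by rewrite linear_sum; apply: eq_bigr => i _; rewrite linearZ.
Qed.

Variable F : forall x : G, U -> tangent G x.
Hypothesis hF : C1_field_family Y F.

(** Near [(x, u)] the map is, in coordinates, the sum over [i] of the [i]-th
    coordinate of [F] times ['d (mul_repr x) (inv_graph x y) (0, e_i)].  Fixing
    the direction [e_i] makes the second factor differentiable in [y], because
    the multiplication is of class C^2. *)
Lemma mdifferentiable_left_triv (x : G) (u : U) :
  mdifferentiable (prod_charted G Y) (vec_charted (lie_algebra G))
    (fun q : G * U => left_triv q.1 (F q.1 q.2)) (x, u).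
Proof.
set c := chart_at G x; set d := chart_at Y u.
pose Phi (q : rV * E) := left_triv (cinv c q.1) (F (cinv c q.1) (cinv d q.2)) : rV.
pose Fc (q : rV * E) := field_repr c (F ^~ (cinv d q.2)) q.1.
pose q0 := (cmap c x, cmap d u).
have dFc : differentiable Fc q0.
  have [+ _] := hF (chart_at_atlas G x) (chart_at_atlas Y u); apply.
  by split; apply: cmap_img; exact: chart_at_dom.
have [_ cl] := mul_repr_class x.
have dfst : differentiable (fst : rV * E -> rV) q0.
  by apply: linear_differentiable => ?; exact: cvg_fst.
have dPhi : differentiable Phi q0.
  pose Psi : rV * E -> rV := \sum_(i < n) (fun q : rV * E => Fc q 0 i *:
     ('d (mul_repr x) (inv_graph x q.1) (0, delta_mx 0 i) : rV)).
  apply: (near_eq_diff (f := Psi) _ _).1.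
    have near_q0 : \forall q \near q0, cimg c q.1 /\
        cdom (chart_at G x^-1%g) (cinv c q.1)^-1%g.
      have cfst : fst @ q0 --> cmap c x := differentiable_continuous dfst.
      exact: cfst _ (near_inv_graph_dom x).
    apply: filterS near_q0 => -[y w] [/= cy dy].
    by rewrite /Psi fct_sumE -diff_mul_repr_sum -left_triv_repr.
  apply: differentiable_sum => i; apply: differentiable_scale.
    apply: (differentiable_comp dFc (g := fun N : rV => N 0 i)).
    exact: differentiable_coord.
  have [dcl _] := cl (0, delta_mx 0 i).
  apply: (differentiable_comp (differentiable_comp dfst (inv_graph_diff x))
    (g := fun q => 'd (mul_repr x) q (0, delta_mx 0 i))).
  apply: dcl; have [] := nbhs_singleton (near_inv_graph_dom x).
  exact: inv_graph_dom.
split; last exact: dPhi.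
have cxu : {for (x, u), continuous (fun q : G * U => (cmap c q.1, cmap d q.2))}.
  apply: (pair_continuous (p := (x, u))); apply: cmap_continuous; exact: chart_at_dom.
have cPhi := continuous_comp cxu (differentiable_continuous dPhi).
have e : \forall q \near (x, u),
    (Phi \o (fun q : G * U => (cmap c q.1, cmap d q.2))) q = left_triv q.1 (F q.1 q.2).
  have : nbhs (x, u) (cdom (prod_chart c d)).
    by apply: near_cdom; split; exact: chart_at_dom.
  by apply: filterS => -[y w] [/= cy dw]; rewrite /Phi /= !cmapK.
pose f (q : G * U) : rV := left_triv q.1 (F q.1 q.2).
have e0 : Phi q0 = f (x, u) by exact: nbhs_singleton e.
have cf : f @ (x, u) --> Phi q0 by apply: cvg_trans cPhi; exact: near_eq_cvg.
by rewrite e0 in cf; exact: cf.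
Qed.

End LeftTrivialization.

(** * Velocities and costates along one step *)

Section AdjointEquation.
Context {R : realType} {n : nat} {G : lieGroup R n} (tau : retraction G).
Local Notation L := (lie_algebra G).

(** The argument on the left is the velocity produced by [velocity_step]; the
    two dual maps undo its transport and leave the old velocity together with
    the variation [delta] of the increment. *)
Lemma costate_step (m : covector L) (z eta delta : L) : ret_dom tau z ->
  dual (Ad (tau z)) (dual ((dret tau z)^-1)%VF m)
    (Ad (tau z)^-1%g (eta + dret tau z delta))
  = dual ((dret tau z)^-1)%VF m eta + m delta.
Proof.
move=> dz; move: (dret tau z) (lker_dret dz) => D kD.
rewrite /dual !comp_lfunE AdK -(linearD m); congr (m _).
apply: etrans (linearD (D^-1)%VF _ _) _; congr (_ + _); exact: lker0_lfunK kD _.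
Qed.

(** The equation [dtau_(- z) = Ad_(tau(z)^-1) dtau_z] ([dretN]) cancels both maps. *)
Lemma costate_terminal (mu : covector L) (z : L) :
  ret_dom tau z -> ret_dom tau (- z) ->
  dual (Ad (tau z)) (dual ((dret tau z)^-1)%VF (dual (dret tau (- z)) mu)) = mu.
Proof.
move=> dz dNz; apply/lfunP => eta.
have := fun v => dretN v dz dNz.
move: (dret tau z) (dret tau (- z)) (lker_dret dz) => D D' kD eD.
rewrite /dual !comp_lfunE; congr (mu _).
apply: etrans (eD _) _; rewrite lker0_lfunVK//.
by have := AdK (tau z)^-1%g eta; rewrite invgK.
Qed.

Context {E : normedVectType R} {U : topologicalType} (Y : charted E U).

Lemma velocity_step (a : U -> G) (zeta : U -> L) (u : U) (du : E) (eta : L) :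
  mdifferentiable Y G a u -> mdifferentiable Y (vec_charted L) zeta u ->
  ret_dom tau (zeta u) -> (mdiff Y G a u du : 'rV[R]_n) = dL (a u) 1%g eta ->
  (mdiff Y G (fun v => a v * tau (zeta v))%g u du : 'rV[R]_n)
  = dL (a u * tau (zeta u))%g 1%g (Ad (tau (zeta u))^-1%g
        (eta + dret tau (zeta u) (mdiff Y (vec_charted L) zeta u du))).
Proof.
move=> da dz dom e.
have dt := mdifferentiable_ret dom.
have dtz := mdifferentiable_comp erefl dz dt.
apply: etrans (mdiff_mulg da dtz du) _.
have et := mdiff_comp du erefl dz dt.
rewrite [X in dR _ _ X]e.
pose w : L := mdiff Y (vec_charted L) zeta u du.
have et' : (mdiff Y G (tau \o zeta) u du : 'rV[R]_n)
    = dR (tau (zeta u)) 1%g (dret tau (zeta u) w).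
  by rewrite dR_dret; exact: et.
apply: etrans (congr2 +%R erefl (congr1 (dL _ _) et')) _.
exact: dL_step.
Qed.

End AdjointEquation.

(** * Covectors and the sensitivity formula *)

(** The adjoint equation, tested on a vector [v]. *)
Lemma covector_recursion {R : realType} {V W W' : vectType R} (A : 'Hom(V, W))
    (B : 'Hom(W, W')) (q p : covector V) (mu : covector W') (c : R) (v : V) :
  q - p = - (c *: dual A (dual B mu)) -> q v + c * mu (B (A v)) = p v.
Proof.
move=> e; have -> : p = q + c *: dual A (dual B mu).
  by apply/esym/eqP; rewrite -subr_eq0 addrAC e addNr.
by rewrite add_lfunE scale_lfunE /dual !comp_lfunE.
Qed.

Lemma covector0 {R : realType} {V W W' : vectType R} (A : 'Hom(V, W))
    (B : 'Hom(W, W')) (mu : covector V) (nu : covector W') (c : R) :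
  mu 0 + c * nu (B (A 0)) = 0.
Proof. by rewrite !linear0 mulr0 addr0. Qed.

Lemma covectorZD {R : realType} {V : vectType R} (mu : covector V) (c : R) (a b : V) :
  mu (c *: (a + b)) = c * mu a + c * mu b.
Proof. by rewrite linearZ /= linearD; exact: mulrDr. Qed.

Theorem proposition4p1 (R : realType) (n p : nat)
    (G : lieGroup R n) (U : manifold R p)
    (C : G -> R^o) (hC : msmooth G (vec_charted R^o) C)
    (F : forall g : G, U -> tangent G g)
    (hF_smooth : forall u : U, smooth_field (F ^~ u))
    (hF_C1 : C1_field_family U F)
    (f : G -> U -> lie_algebra G)
    (hf : forall (g : G) (u : U), f g u = left_triv g (F g u))
    (tau : retraction G) (N : nat) (hN : (1 <= N)%N)
    (dt : R) (hdt : 0 < dt) (g0 : G)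
    (g : nat -> U -> G) (xi : nat -> U -> lie_algebra G)
    (hg0 : forall u : U, g 0%N u = g0)
    (hxi : forall (u : U) (k : nat), (k < N)%N -> xi k.+1 u = f (g k u) u)
    (hg : forall (u : U) (k : nat), (k < N)%N ->
      g k.+1 u = (g k u * tau (dt *: xi k.+1 u))%g)
    (u : U)
    (hdom : forall k : nat, (1 <= k <= N)%N ->
      ret_dom tau (dt *: xi k u) /\ ret_dom tau (- (dt *: xi k u)))
    (m : nat -> covector (lie_algebra G))
    (hm : forall k : nat, (1 <= k <= N.-1)%N ->
      dual ((dret tau (dt *: xi k.+1 u))^-1)%VF (m k.+1)
      - dual (Ad (tau (dt *: xi k u)))
          (dual ((dret tau (dt *: xi k u))^-1)%VF (m k))
      = - (dt *: dual (T1L (g k u))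
                   (dual (mdiff G (vec_charted (lie_algebra G)) (f ^~ u) (g k u))
                      (m k.+1))))
    (hmN : m N = dual (dret tau (- (dt *: xi N u))) (left_deriv C (g N u))) :
  mdifferentiable U (vec_charted R^o) (fun v : U => C (g N v)) u /\
  forall du : tangent U u,
    mdiff U (vec_charted R^o) (fun v : U => C (g N v)) u du
    = dt * \sum_(0 <= j < N)
             m j.+1 (mdiff U (vec_charted (lie_algebra G)) (f (g j u)) u du).
Proof.
set L := lie_algebra G.
have df (x : G) (v : U) : mdifferentiable (prod_charted G U) (vec_charted L)
    (fun q : G * U => f q.1 q.2) (x, v).
  have -> : (fun q : G * U => f q.1 q.2) = (fun q => left_triv q.1 (F q.1 q.2)).
    by apply/funext => q; exact: hf.
  exact: mdifferentiable_left_triv.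
pose dfu j (du : tangent U u) := m j.+1 (mdiff U (vec_charted L) (f (g j u)) u du).
pose p_ k : covector L := dual (Ad (tau (dt *: xi k u)))
  (dual ((dret tau (dt *: xi k u))^-1)%VF (m k)).
(* The adjoint equation starts at k = 1; at k = 0 its place is taken by
   eta = 0, since g 0 does not depend on the parameter. *)
have adjoint k (eta : L) (du : tangent U u) : (k < N)%N ->
    (if k is 0 then eta = 0 else p_ k eta = dt * \sum_(0 <= j < k) dfu j du) ->
    dual ((dret tau (dt *: xi k.+1 u))^-1)%VF (m k.+1) eta
    + dt * m k.+1 (mdiff G (vec_charted L) (f ^~ u) (g k u) (T1L (g k u) eta))
    = dt * \sum_(0 <= j < k) dfu j du.
  case: k => [_ ->|k ltkN <-].
    rewrite big_geq// mulr0; exact: covector0.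
  have hk : (1 <= k.+1 <= N.-1)%N by rewrite ltn_predRL.
  exact: covector_recursion (hm _ hk).
(* Neither xi 0 nor m 0 is constrained, so the pairing starts at k = 1. *)
have inv k : (k <= N)%N -> mdifferentiable U G (g k) u /\
    forall du : tangent U u, exists2 eta : L,
      mdiff U G (g k) u du = dL (g k u) 1%g eta :> 'rV[R]_n &
      if k is 0 then eta = 0 else p_ k eta = dt * \sum_(0 <= j < k) dfu j du.
  elim: k => [_|k IHk ltkN].
    have g0E : g 0%N = cst g0 by apply/funext.
    split; first by rewrite g0E; exact: mdifferentiable_cst.
    move=> du; exists 0 => //; rewrite g0E.
    apply: etrans (mdiff_cst _ _ _ _ _) _.
    exact: (esym (linear0 (dL g0 1%g))).
  have [dgk velk] := IHk (ltnW ltkN).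
  pose zeta (v : U) : L := dt *: f (g k v) v.
  have zE : zeta u = dt *: xi k.+1 u by rewrite hxi.
  have gE : g k.+1 = (fun v => g k v * tau (zeta v))%g.
    by apply/funext => v; rewrite hg// hxi.
  have [dom _] := hdom k.+1 ltkN.
  have dom' : ret_dom tau (zeta u) by rewrite zE.
  have dxi := mdifferentiable_total (df (g k u) u) dgk.
  have dz : mdifferentiable U (vec_charted L) zeta u := mdifferentiable_scaler dt dxi.
  split.
    rewrite gE; apply: mdifferentiable_mulg => //.
    exact: mdifferentiable_comp erefl dz (mdifferentiable_ret dom').
  move=> du; have [eta ve ce] := velk du.
  exists (Ad (tau (zeta u))^-1%g
           (eta + dret tau (zeta u) (mdiff U (vec_charted L) zeta u du))).
    rewrite gE; exact: velocity_step.
  rewrite /p_ -zE costate_step//.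
  have ez : mdiff U (vec_charted L) zeta u du
     = dt *: (mdiff G (vec_charted L) (f ^~ u) (g k u) (T1L (g k u) eta)
       + mdiff U (vec_charted L) (f (g k u)) u du) :> L.
    apply: etrans (mdiff_scaler dt dxi du) _.
    have e2 := mdiff_total (df (g k u) u) dgk du.
    have e3 := congr1 (mdiff G (vec_charted L) (f ^~ u) (g k u)) ve.
    apply: (congr1 (fun t : L => dt *: t)).
    exact: etrans e2 (congr2 +%R e3 erefl).
  rewrite {}ez.
  set a := mdiff G _ _ _ _; set b := mdiff U _ _ _ _.
  have mab : m k.+1 (dt *: (a + b)) = dt * m k.+1 a + dt * m k.+1 b :> R.
    exact: covectorZD.
  apply: etrans (congr1 (fun t : R => _ + t) mab) _.
  rewrite big_nat_recr//= mulrDr addrA; congr (_ + _).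
  rewrite zE; exact: adjoint.
have [dgN velN] := inv N (leqnn N).
have dC : mdifferentiable G (vec_charted R^o) C (g N u).
  exact: (mclass_on_mdifferentiable (hC 1%N)).
split; first exact: mdifferentiable_comp erefl dgN dC.
move=> du; have [eta ve ce] := velN du.
have eC := mdiff_comp du erefl dgN dC.
apply: etrans eC _.
apply: etrans (congr1 (mdiff G (vec_charted R^o) C (g N u)) ve) _.
have pN : p_ N eta = dt * \sum_(0 <= j < N) dfu j du.
  by move: ce; case: (N) (hN).
apply: etrans _ pN.
have [dz dNz] : ret_dom tau (dt *: xi N u) /\ ret_dom tau (- (dt *: xi N u)).
  by apply: hdom; rewrite hN leqnn.
by rewrite /p_ hmN costate_terminal// /left_deriv /dual comp_lfunE.
Qed.
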